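(* Let $n\in\mathbb{N}$, $R=\{1,3,9n-1,9n+1\}$, $S=\{3,3n+1,6n-1,12n+1\}$ and $T=\{3,3n-1,6n+1,12n-1\}$. Then $C_{27n}(R)$, $C_{27n}(S)$ and $C_{27n}(T)$ are Type-2 isomorphic circulant graphs w.r.t. $m=3$, $T2_{27n,3}(C_{27n}(R))=T2_{27n,3}(C_{27n}(S))=T2_{27n,3}(C_{27n}(T))=\{C_{27n}(R),C_{27n}(S),C_{27n}(T)\}$, and $(T2_{27n,3}(C_{27n}(R)),\circ)=(T2_{27n,3}(C_{27n}(S)),\circ)=(T2_{27n,3}(C_{27n}(T)),\circ)$ is a group (the Type-2 group).
   Context: Circulant graph $C_N(R)$: vertices $v_0,\dots,v_{N-1}$, $v_x$ adjacent to $v_{x\pm s}$, $s\in R$; jump sets written in $[1,N/2]$ after reflexive reduction modulo $N$ (reduce mod $N$, replace values $>N/2$ by $N$ minus the value). For $m\mid N$, $0\le t\le\tfrac Nm-1$, $\theta_{N,m,t}$ maps $v_x$, $x=qm+j$, $0\le j\le m-1$, to $u_{x+jmt}$ (subscripts mod $N$) and edges to pairs of images; $\theta_{N,m,t}(C_N(R))$ is the image graph, written $C_N(\theta_{N,m,t}(R))$. Type-2 isomorphism w.r.t. $m$: $C_N(R)$, $C_N(S)$ with $|R|=|S|\ge3$, $R\ne S$, are Type-2 isomorphic w.r.t. $m$ if some $r\in R$ has $m>1$, $m\mid\gcd(N,r)$, $m^3\mid N$, $\theta_{N,m,t}(C_N(R))=C_N(S)$ for some $1\le t\le\tfrac Nm-1$,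 and $S\ne xR$ (reflexive mod $N$) for all $x$ coprime to $N$. $T2_{N,m}(C_N(R))=\{C_N(R)\}\cup\{C_N(S):C_N(S)$ Type-2 isomorphic to $C_N(R)$ w.r.t. $m\}$, with operation $\theta_{N,m,t}(C_N(R))\circ\theta_{N,m,t'}(C_N(R))=\theta_{N,m,t+t'}(C_N(R))$, $t+t'$ modulo $\tfrac Nm$.
   Formalization: The operation ∘ depends on its base graph, so the three groups, each with its own ∘, are not literally equal; proved instead: the pairs agree when one common ∘ (of base R, S or T) is used, each T2 with its own ∘ is a group, and these groups are pairwise isomorphic. *)

(* Defs.v *)
From HB Require Import structures.
From mathcomp Require Import all_boot finmap.
From mathcomp Require Import boolp classical_sets.

Local Open Scope classical_set_scope.

(* A labelled graph on the vertices 0, ..., N-1, given by its set of edges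
   (unordered pairs).  The vertices v_i and u_i are both the ordinal i, so that
   equality of graphs is equality of labelled graphs. *)
Definition graph (N : nat) : Type := set (set 'I_N).

Definition jump_set (N : nat) (R : {fset nat}) : Prop :=
  forall s, s \in R -> 0 < s /\ s.*2 <= N.

Definition circulant (N : nat) (R : {fset nat}) : graph N :=
  [set e | exists x y : 'I_N, e = [set x; y] /\
     exists2 s, s \in R & y = x + s %[mod N] \/ y + s = x %[mod N]].

(* x = q m + j with 0 <= j < m is sent to x + j m t modulo N *)
Definition theta {N : nat} (m t : nat) (x : 'I_N) : 'I_N :=
  Ordinal (ltn_pmod (x + (x %% m) * m * t) (leq_ltn_trans (leq0n x) (ltn_ord x))).

Definition theta_graph {N : nat} (m t : nat) (G : graph N) : graph N :=
  [set [set theta m t x | x in e] | e in G].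

Definition reflexive_mod (N a : nat) : nat :=
  if N < (a %% N).*2 then N - a %% N else a %% N.

Definition jump_mul (N x : nat) (R : {fset nat}) : {fset nat} :=
  [fset reflexive_mod N (x * r) | r in R]%fset.

Definition type2_iso (N m : nat) (R S : {fset nat}) : Prop :=
  [/\ jump_set N R, jump_set N S, #|` R| = #|` S|, 3 <= #|` R| & R <> S] /\
  exists2 r, r \in R &
    [/\ 1 < m, m %| gcdn N r, m ^ 3 %| N,
        exists2 t, 1 <= t <= N %/ m - 1 &
          theta_graph m t (circulant N R) = circulant N S
      & forall x, coprime x N -> S <> jump_mul N x R].

Definition T2 (N m : nat) (R : {fset nat}) : set (graph N) :=
  [set circulant N R] `|`
  [set G | exists2 S, G = circulant N S & type2_iso N m R S].

(* G o H = K.  The operation is a relation, because t is not determined by the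
   graph theta_t (C_N(R)); it refers to the base graph C_N(R). *)
Definition T2_op (N m : nat) (R : {fset nat}) (G H K : graph N) : Prop :=
  exists t t' : nat,
    [/\ t < N %/ m /\ t' < N %/ m,
        G = theta_graph m t (circulant N R),
        H = theta_graph m t' (circulant N R)
      & K = theta_graph m ((t + t') %% (N %/ m)) (circulant N R)].

(* op restricts to a single-valued operation on A, for which A is a group that
   f identifies with gT *)
Definition group_iso {T : Type} (gT : groupType) (A : set T)
    (op : T -> T -> T -> Prop) : Prop :=
  exists f : gT -> T,
    [/\ injective f, range f = A
      & forall a b K, op (f a) (f b) K <-> K = f (a * b)%g].

Definition is_group {T : Type} (A : set T) (op : T -> T -> T -> Prop) : Prop :=
  exists gT : groupType, group_iso gT A op.

Definition groups_isomorphic {T : Type} (A B : set T)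
    (opA opB : T -> T -> T -> Prop) : Prop :=
  exists gT : groupType, group_iso gT A opA /\ group_iso gT B opB.

(* Main.v *)
Require Import Defs.
From mathcomp Require Import all_boot finmap.
From mathcomp Require Import boolp classical_sets.
From mathcomp Require Import ssralg ssrnum ssrint intdiv zmodp.
From mathcomp Require Import zify.

(* Vertices differ by an admissible jump of R, S, T (indexed by c = 0, 1, 2) iff
   their difference is +-3 modulo 27n or +-(1 + 3nc) modulo 9n.  The map theta_t
   preserves residues modulo 3 and fixes differences divisible by 3; a difference
   d = 1 mod 3 becomes d + 3t when it starts in the classes 0 or 1 and d - 6t when
   it starts in the class 2.  The image is therefore circulant only if 9t is a
   multiple of 9n, and theta_(nk) sends c to c + k modulo 3, so that the operation
   is addition in Z/3.  If x is a unit and x * J_c = J_c', then 3 is the only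
   multiple of 3 on both sides, whence x = +-1 modulo 9n and c = c'. *)

(** * Edges of circulant graphs as congruences on differences *)

Lemma eqz_modP (d a b : int) :
  (a = b %[mod d])%Z <-> exists q : int, a = (b + q * d)%R.
Proof.
split=> [/eqP|[q ->]]; last by rewrite GRing.addrC modzMDl.
by rewrite eqz_mod_dvd => /dvdzP[q abq]; exists q; lia.
Qed.

Lemma classic_set2_eq (T : Type) (x y x' y' : T) :
  [set x; y]%classic = [set x'; y']%classic ->
  (x = x' /\ y = y') \/ (x = y' /\ y = x').
Proof.
move=> exy.
have x'P : [set x; y]%classic x' by rewrite exy; left.
have y'P : [set x; y]%classic y' by rewrite exy; right.
have xP : [set x'; y']%classic x by rewrite -exy; left.
have yP : [set x'; y']%classic y by rewrite -exy; right.
by case: x'P y'P xP yP => [->|->] [->|->] [] /= ? [] /= ?; subst; tauto.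
Qed.

(** Swapping the endpoints negates the difference, and the condition is symmetric under negation, so
    it can be tested on either ordering of the pair. *)
Lemma circulantP (N : nat) (A : {fset nat}) (x y : 'I_N) :
  circulant N A [set x; y]%classic <->
  exists2 s : nat, s \in A & ((y%:Z - x%:Z)%R = s %[mod N])%Z \/
                             ((y%:Z - x%:Z)%R = - s%:Z %[mod N])%Z.
Proof.
have modP (a b s : nat) : b = a + s %[mod N] <-> ((b%:Z - a%:Z)%R = s %[mod N])%Z.
  have <- : (b%:Z = (a + s)%N %[mod N])%Z <-> b = a + s %[mod N].
    by rewrite !modz_nat; split=> [[]|->].
  by split=> /eqz_modP[q e]; apply/eqz_modP; exists q; lia.
have modNP (a b s : nat) : b + s = a %[mod N] <-> ((b%:Z - a%:Z)%R = - s%:Z %[mod N])%Z.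
  have -> : b + s = a %[mod N] <-> a = b + s %[mod N] by split=> ->.
  by rewrite modP; split=> /eqz_modP[q e]; apply/eqz_modP; exists (- q)%R; lia.
split=> [[x' [y' [exy [s sA xys]]]]|[s sA xys]]; last first.
  by exists x, y; split=> //; exists s => //; case: xys => [/modP|/modNP]; [left|right].
exists s => //.
suff: y = x + s %[mod N] \/ y + s = x %[mod N] by case=> [/modP|/modNP]; [left|right].
by case: (classic_set2_eq _ _ _ _ _ exy) xys => -[-> ->] => [|[] ->]; auto.
Qed.

(** Translation invariance: the one property of an arbitrary circulant graph that [theta_graph_dvd]
    exploits. *)
Lemma circulant_diff (N : nat) (A : {fset nat}) (x y x' y' : 'I_N) :
  ((y%:Z - x%:Z)%R = (y'%:Z - x'%:Z)%R %[mod N])%Z ->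
  circulant N A [set x; y]%classic -> circulant N A [set x'; y']%classic.
Proof. by move=> e; rewrite !circulantP e. Qed.

Lemma reflexive_modP (N a : nat) : 0 < N ->
  ((reflexive_mod N a)%:Z = a %[mod N])%Z \/ ((reflexive_mod N a)%:Z = - a%:Z %[mod N])%Z.
Proof.
move=> N_gt0; have aN := ltn_pmod a N_gt0; have aE := divn_eq a N.
rewrite /reflexive_mod; case: ifP => _; [right|left]; apply/eqz_modP.
- by exists ((a %/ N)%N%:Z + 1)%R; lia.
- by exists (- (a %/ N)%N%:Z)%R; lia.
Qed.

Lemma cardfs4 (K : choiceType) (a b c d : K) :
  uniq [:: a; b; c; d] -> #|` [fset a; b; c; d]%fset| = 4.
Proof.
move=> /= /and4P[]; rewrite !inE => abcd bcd cd _.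
by rewrite -!fsetUA !cardfsU1 cardfs1 !inE (negbTE abcd) (negbTE bcd) (negbTE cd).
Qed.

(** * The three jump sets and their common description *)

Section Jumps.
Variable n : nat.
Hypothesis n_gt0 : 0 < n.
Local Notation N := (27 * n).

Definition jumps (c : nat) : {fset nat} :=
  match c with
  | 0 => [fset 1; 3; (9 * n - 1)%N; (9 * n + 1)%N]
  | 1 => [fset 3; (3 * n + 1)%N; (6 * n - 1)%N; (12 * n + 1)%N]
  | _ => [fset 3; (3 * n - 1)%N; (6 * n + 1)%N; (12 * n - 1)%N]
  end%fset.

Definition is_jump (c : nat) (d : int) : Prop :=
  [\/ (d = 3 %[mod N])%Z, (d = -3 %[mod N])%Z,
      (d = (1 + 3 * n * c)%N %[mod (9 * n)%N])%Z
    | (d = - (1 + 3 * n * c)%:Z %[mod (9 * n)%N])%Z].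

Lemma is_jumpP c d : c < 3 ->
  (exists2 s, s \in jumps c & (d = s %[mod N])%Z \/ (d = - s%:Z %[mod N])%Z) <->
  is_jump c d.
Proof.
move=> c3; split.
- case: c c3 => [|[|[|//]]] _ [s] /=; rewrite !inE -!orbA => /or4P[]/eqP-> [] /eqz_modP[q dq];
    first  [ by apply: Or41; apply/eqz_modP; exists q; lia
             | by apply: Or42; apply/eqz_modP; exists q; lia
             | by apply: Or43; apply/eqz_modP; first
                 [ by exists (3 * q)%R; lia | by exists (3 * q + 1)%R; lia
                 | by exists (3 * q - 1)%R; lia | by exists (3 * q - 2)%R; lia]
             | by apply: Or44; apply/eqz_modP; first
                 [ by exists (3 * q)%R; lia | by exists (3 * q + 1)%R; lia
                 | by exists (3 * q - 1)%R; lia | by exists (3 * q + 2)%R; lia] ].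
- case=> /eqz_modP[q dq].
  + by exists 3; [case: c c3 => [|[|[]]] //; rewrite !inE ?orbT | left; apply/eqz_modP; exists q].
  + by exists 3; [case: c c3 => [|[|[]]] //; rewrite !inE ?orbT | right; apply/eqz_modP; exists q].
  (* The remainder of [q] modulo 3 selects the lift. The nine cases give [1 + 3ni] for [i] from 0 to
     8 in order; from [i = 5] on, the lift exceeds [N/2] and is replaced by its opposite. *)
  + have [k kq] : exists k : int, q = (3 * k)%R \/ q = (3 * k + 1)%R \/ q = (3 * k + 2)%R.
      by exists (q %/ 3)%Z; lia.
    case: kq dq => [|[]] -> dq; case: c c3 dq => [|[|[|//]]] _ dq;
    [exists 1|exists (3 * n + 1)|exists (6 * n + 1)|exists (9 * n + 1)|exists (12 * n + 1)
    |exists (12 * n - 1)|exists (9 * n - 1)|exists (6 * n - 1)|exists (3 * n - 1)];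
    by [ rewrite !inE eqxx ?orbT
       | (left; apply/eqz_modP; exists k; lia)
        || (right; apply/eqz_modP; exists (k + 1)%R; lia)].
  + have [k kq] : exists k : int, q = (3 * k)%R \/ q = (3 * k - 1)%R \/ q = (3 * k - 2)%R.
      by exists ((q + 2) %/ 3)%Z; lia.
    case: kq dq => [|[]] -> dq; case: c c3 dq => [|[|[|//]]] _ dq;
    [exists 1|exists (3 * n + 1)|exists (6 * n + 1)|exists (9 * n + 1)|exists (12 * n + 1)
    |exists (12 * n - 1)|exists (9 * n - 1)|exists (6 * n - 1)|exists (3 * n - 1)];
    by [ rewrite !inE eqxx ?orbT
       | (right; apply/eqz_modP; exists k; lia)
        || (left; apply/eqz_modP; exists (k - 1)%R; lia)].
Qed.

Lemma circulant_jumpsP c (x y : 'I_N) : c < 3 ->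
  circulant N (jumps c) [set x; y]%classic <-> is_jump c (y%:Z - x%:Z)%R.
Proof. by move=> c3; rewrite circulantP is_jumpP. Qed.

(** Such a [d] is 1 or -1 modulo 3, which rules out the jumps 3 and -3 and fixes the sign.
    Cancelling [3n] then leaves [c = c'] modulo 3. *)
Lemma is_jump_inj (c c' : nat) (d : int) : c < 3 -> c' < 3 ->
  (d = (1 + 3 * n * c)%N %[mod (9 * n)%N])%Z \/
  (d = - (1 + 3 * n * c)%:Z %[mod (9 * n)%N])%Z ->
  is_jump c' d -> c = c'.
Proof.
have nn (w : int) : (n%:Z * (c'%:Z - c%:Z - 3 * w) = 0)%R -> c < 3 -> c' < 3 -> c = c'.
  by move/eqP; rewrite GRing.mulf_eq0 => /orP[/eqP|/eqP]; lia.
move=> c3 c'3 [] /eqz_modP[p ->] [] /eqz_modP[q]; try lia.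
- by move=> e; apply: (nn (p - q)%R) => //; lia.
- by move=> e; apply: (nn (q - p)%R) => //; lia.
Qed.

(** Here [e] stands for a difference of residues modulo 3. If 3 divides [d], the bound on [e] forces
    [e = 0] and [d] is kept modulo [N]. Otherwise only [e] modulo 3 matters, since [9n] absorbs the
    rest, and the shift is [3nk] with the sign of the jump. *)
Lemma is_jump_shift (c c' : nat) (k d e i : int) :
  (c' = c%:Z + k %[mod 3])%Z -> (d = e %[mod 3])%Z -> (-3 < e < 3)%R ->
  is_jump c d -> is_jump c' (d + 3 * n%:Z * k * e + N%:Z * i)%R.
Proof.
move=> /eqz_modP[j c'E] /eqz_modP[w dE] e3.
have {c'E} c'E : (3 * n%:Z * c'%:Z = 3 * n%:Z * c%:Z + 3 * n%:Z * k + 9 * n%:Z * j)%R.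
  by rewrite c'E; lia.
case=> /eqz_modP[q].
- move=> dq; have -> : e = 0%R by lia.
  by apply: Or41; apply/eqz_modP; exists (q + i)%R; lia.
- move=> dq; have -> : e = 0%R by lia.
  by apply: Or42; apply/eqz_modP; exists (q + i)%R; lia.
- move=> dq; have [v ->] : exists v, e = (1 + 3 * v)%R.
    by exists (n%:Z * c%:Z + 3 * n%:Z * q - w)%R; lia.
  by apply: Or43; apply/eqz_modP; exists (q + 3 * i + k * v - j)%R; lia.
- move=> dq; have [v ->] : exists v, e = (3 * v - 1)%R.
    by exists (3 * n%:Z * q - n%:Z * c%:Z - w)%R; lia.
  by apply: Or44; apply/eqz_modP; exists (q + 3 * i + k * v + j)%R; lia.
Qed.

(** * The action of [theta] on edges *)

Lemma theta3E (t : nat) (x : 'I_N) :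
  ((theta 3 t x)%:Z = (x + 3 * t * (x %% 3))%N %[mod N])%Z.
Proof. by rewrite !modz_nat /theta /= modn_mod; do 2 f_equal; lia. Qed.

Lemma theta3_mod3 (t : nat) (x : 'I_N) : theta 3 t x = x %[mod 3].
Proof. by have /eqz_modP[q] := theta3E t x; lia. Qed.

Lemma theta3_inj t : injective (@theta N 3 t).
Proof.
move=> x y xy; have x3y3 : x = y %[mod 3] by rewrite -(theta3_mod3 t x) xy theta3_mod3.
have /eqz_modP[p pE] := theta3E t x; have /eqz_modP[q qE] := theta3E t y.
have: (x%:Z = y %[mod N])%Z.
  by apply/eqz_modP; exists (q - p)%R; move: pE qE; rewrite xy x3y3; lia.
by rewrite !modz_nat => -[]; rewrite !modn_small // => /val_inj.
Qed.

Lemma theta_circulant_jumps c k (x y : 'I_N) : c < 3 ->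
  circulant N (jumps ((c + k) %% 3)) [set theta 3 (n * k) x; theta 3 (n * k) y]%classic <->
  circulant N (jumps c) [set x; y]%classic.
Proof.
move=> c3; rewrite !circulant_jumpsP ?ltn_pmod //.
have /eqz_modP[p pE] := theta3E (n * k) x; have /eqz_modP[q qE] := theta3E (n * k) y.
have xm := theta3_mod3 (n * k) x; have ym := theta3_mod3 (n * k) y.
set X := nat_of_ord (theta _ _ x) in pE xm *; set Y := nat_of_ord (theta _ _ y) in qE ym *.
(* [theta] with parameter [nk] adds [3nk] times the residue of each vertex, hence [3nk * e] to the
   difference. *)
pose e : int := ((y %% 3)%N%:Z - (x %% 3)%N%:Z)%R.
have e3 : (-3 < e < 3)%R by rewrite /e; lia.
have E : (Y%:Z - X%:Z = y%:Z - x%:Z + 3 * n%:Z * k%:Z * e + N%:Z * (q - p))%R.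
  by rewrite pE qE /e; lia.
split=> H.
(* The converse is the same shift with [-k]. *)
- have -> : (y%:Z - x%:Z = Y%:Z - X%:Z + 3 * n%:Z * - k%:Z * e + N%:Z * (p - q))%R by lia.
  apply: is_jump_shift H => //; first by apply/eqz_modP; exists ((c + k) %/ 3)%N; lia.
  by apply/eqz_modP; exists ((Y %/ 3)%N%:Z - (X %/ 3)%N%:Z)%R; rewrite /e; lia.
- rewrite E; apply: is_jump_shift H => //.
    by apply/eqz_modP; exists (- ((c + k) %/ 3)%N%:Z)%R; lia.
  by apply/eqz_modP; exists ((y %/ 3)%N%:Z - (x %/ 3)%N%:Z)%R; rewrite /e; lia.
Qed.

Lemma theta_set2 t (x y : 'I_N) :
  [set theta 3 t z | z in [set x; y]]%classic = [set theta 3 t x; theta 3 t y]%classic.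
Proof. by rewrite image_setU !image_set1. Qed.

Lemma theta_graph_jumps c k : c < 3 ->
  theta_graph 3 (n * k) (circulant N (jumps c)) = circulant N (jumps ((c + k) %% 3)).
Proof.
move=> c3; apply/seteqP; split=> [_ [e Ee <-]|e Ee].
  case: (Ee) => x [y [exy _]]; rewrite exy in Ee *.
  by rewrite theta_set2 theta_circulant_jumps.
case: (Ee) => X [Y [eXY _]]; rewrite {e}eXY in Ee *.
have [g _ thK] := injF_bij (@theta3_inj (n * k)).
exists [set g X; g Y]%classic; last by rewrite theta_set2 !thK.
by apply/(theta_circulant_jumps _ k) => //; rewrite !thK.
Qed.

Let N_gt0 : 0 < N. Proof. by rewrite muln_gt0. Qed.
Let vertex a : 'I_N := Ordinal (ltn_pmod a N_gt0).

Let vertexE a : exists q : int, ((vertex a)%:Z = a%:Z + q * N%:Z)%R.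
Proof. by apply/eqz_modP; rewrite !modz_nat /= modn_mod. Qed.

(** Put [d = 1 + 3nc]. The edge from 0 to [d] has an image with difference [d + 3t]; circulance
    moves this image to start at 2. There it must come from an edge leading from class 2 to class 0,
    whose difference is [d + 9t] modulo [N]. Being 1 modulo 3, this jump agrees with [d] modulo
    [9n], so [9n] divides [9t]. *)
Lemma theta_graph_dvd c t (A : {fset nat}) : c < 3 ->
  theta_graph 3 t (circulant N (jumps c)) = circulant N A -> n %| t.
Proof.
move=> c3 eqG; pose x := vertex 0; pose y := vertex (1 + 3 * n * c).
have Hxy : circulant N A [set theta 3 t x; theta 3 t y]%classic.
  rewrite -eqG -theta_set2; exists [set x; y]%classic => //.
  apply/circulant_jumpsP => //; have [p pE] := vertexE 0; have [q qE] := vertexE (1 + 3 * n * c).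
  by apply: Or43; apply/eqz_modP; exists (3 * (q - p))%R; rewrite /x /y pE qE; lia.
(* (x1, y1) is the translate of the image edge (theta x, theta y) starting at 2. *)
pose x1 := vertex 2; pose y1 := vertex (2 + theta 3 t y + (N - theta 3 t x)).
have [x0 x0E] := vertexE 0; have [y0 y0E] := vertexE (1 + 3 * n * c).
have [x1q x1E] := vertexE 2; have [y1q y1E] := vertexE (2 + theta 3 t y + (N - theta 3 t x)).
have /eqz_modP[xq xE] := theta3E t x; have /eqz_modP[yq yE] := theta3E t y.
rewrite -/x -/y -/x1 -/y1 in x0E y0E x1E y1E.
have thN := ltn_ord (theta 3 t x).
have Hx1y1 : circulant N A [set x1; y1]%classic.
  by apply: circulant_diff Hxy; apply/eqz_modP; exists (x1q - y1q - 1)%R; lia.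
have [p pE] : exists p : int, (y1%:Z - x1%:Z = 1 + 3 * n%:Z * c%:Z + 3 * t%:Z + N%:Z * p)%R.
  have x30 : x %% 3 = 0 by lia.
  have y31 : y %% 3 = 1 by lia.
  move: xE yE; rewrite x30 y31 => xE yE.
  by exists (y1q + yq + y0 + 1 - xq - x0 - x1q)%R; lia.
rewrite -eqG in Hx1y1; case: Hx1y1 => e Ee.
case: (Ee) => x' [y' [exy _]]; rewrite {e}exy in Ee *.
rewrite theta_set2 => e12.
wlog [e1 e2] : x' y' Ee {e12} / theta 3 t x' = x1 /\ theta 3 t y' = y1.
  move=> H; case: (classic_set2_eq _ _ _ _ _ e12) => -[e1 e2]; first exact: (H x' y').
  by apply: (H y' x') => //; rewrite classical_sets.setUC.
have /eqz_modP[u uE] := theta3E t x'; have /eqz_modP[v vE] := theta3E t y'.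
rewrite e1 in uE; rewrite e2 in vE.
have x'2 : x' %% 3 = 2 by lia.
have y'0 : y' %% 3 = 0 by lia.
rewrite x'2 in uE; rewrite y'0 in vE.
have tP (w : int) : (t%:Z = w * n%:Z)%R -> n %| t.
  by move=> tE; have /dvdzP : exists w : int, (t%:Z = w * n%:Z)%R by exists w.
move/circulant_jumpsP: Ee => /(_ c3)[] /eqz_modP[q qE]; try lia.
by apply: (tP (q - 3 * p - 3 * (u - v))%R); lia.
Qed.

(** * Distinct indices give Type-2 isomorphic graphs *)

Lemma circulant_jumps_inj c c' : c < 3 -> c' < 3 ->
  circulant N (jumps c) = circulant N (jumps c') -> c = c'.
Proof.
move=> c3 c'3 eqG; pose x := vertex 0; pose y := vertex (1 + 3 * n * c).
have [p pE] := vertexE 0; have [q qE] := vertexE (1 + 3 * n * c).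
have H : ((y%:Z - x%:Z)%R = (1 + 3 * n * c)%N %[mod (9 * n)%N])%Z.
  by apply/eqz_modP; exists (3 * (q - p))%R; rewrite /x /y pE qE; lia.
have : circulant N (jumps c) [set x; y]%classic by apply/circulant_jumpsP => //; apply: Or43.
by rewrite eqG circulant_jumpsP //; apply: is_jump_inj => //; left.
Qed.

Lemma jumps_jump_set c : c < 3 -> jump_set N (jumps c).
Proof. by case: c => [|[|[|//]]] _ s; rewrite !inE -!orbA => /or4P[]/eqP->; lia. Qed.

Lemma card_jumps c : c < 3 -> #|` jumps c| = 4.
Proof. by case: c => [|[|[|//]]] _; rewrite cardfs4 //= !inE; lia. Qed.

Lemma jumpsP c s : c < 3 -> s \in jumps c -> is_jump c s%:Z.
Proof. by move=> c3 sJ; apply/is_jumpP => //; exists s => //; left. Qed.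

Lemma jumps_neq_mul c c' x : c < 3 -> c' < 3 -> c <> c' -> coprime x N ->
  jumps c' <> jump_mul N x (jumps c).
Proof.
move=> c3 c'3 cc' xN eqJ; apply: cc'.
have x3 : ~~ (3 %| x).
  apply/negP => /dvdnP[q xq].
  move: xN; rewrite xq (_ : 27 * n = 9 * n * 3); last lia.
  by rewrite /coprime -muln_gcdl; lia.
have: 3 \in jump_mul N x (jumps c).
  by rewrite -eqJ; case: c' c'3 {eqJ} => [|[|[]]] //; rewrite !inE ?orbT.
case/imfsetP => r /= /(jumpsP _ _ c3) rJ rE.
(* Since 3 does not divide [x], it divides [r], so [r] is 3 or -3 modulo [N]. Dividing [3x = 3] or
   [3x = -3] modulo [27n] by 3 gives [x] modulo [9n]. *)
have xP : exists q : int, (x%:Z = 1 + 9 * n%:Z * q)%R \/ (x%:Z = - 1 + 9 * n%:Z * q)%R.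
  have xr3 := reflexive_modP N (x * r) N_gt0.
  rewrite -rE in xr3.
  have xr : 3 %| r.
    suff: 3 %| x * r by rewrite Euclid_dvdM // (negbTE x3).
    apply/dvdnP; exists ((x * r) %/ 3).
    by case: xr3 => /eqz_modP[p pE]; lia.
  case/dvdnP: xr => r' r'E.
  case: rJ => /eqz_modP[q qE]; try lia; rewrite (PoszM x r) qE in xr3.
  - by case: xr3 => /eqz_modP[p pE];
      [exists (- (p + q * x))%R; left|exists (p - q * x)%R; right]; lia.
  - by case: xr3 => /eqz_modP[p pE];
      [exists (p + q * x)%R; right|exists (q * x - p)%R; left]; lia.
(* Multiplying by [x] only changes signs modulo [9n], so a jump [s] lying over [1 + 3nc] up to sign
   yields a jump of index [c'] over the same class. *)
have [s sJ sE] : exists2 s : nat, s \in jumps c &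
    ((1 + 3 * n * c)%N = s%:Z %[mod N])%Z \/ ((1 + 3 * n * c)%N = - s%:Z %[mod N])%Z.
  by apply/is_jumpP => //; apply: Or43.
have s'J : reflexive_mod N (x * s) \in jumps c' by rewrite eqJ; apply/imfsetP; exists s.
apply: is_jump_inj (jumpsP _ _ c'3 s'J) => //.
case: xP => q xE.
have [p pE] : exists p : int, ((reflexive_mod N (x * s))%:Z = s%:Z + 9 * n%:Z * p)%R \/
    ((reflexive_mod N (x * s))%:Z = - s%:Z + 9 * n%:Z * p)%R.
  case: (reflexive_modP N (x * s) N_gt0) => /eqz_modP[p ->];
  case: xE => xE; rewrite (PoszM x s) xE.
  - by exists (q * s + 3 * p)%R; left; lia.
  - by exists (q * s + 3 * p)%R; right; lia.
  - by exists (3 * p - q * s)%R; right; lia.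
  - by exists (3 * p - q * s)%R; left; lia.
case: pE => ->; case: sE => /eqz_modP[u uE].
- by left; apply/eqz_modP; exists (p - 3 * u)%R; lia.
- by right; apply/eqz_modP; exists (p + 3 * u)%R; lia.
- by right; apply/eqz_modP; exists (p + 3 * u)%R; lia.
- by left; apply/eqz_modP; exists (p - 3 * u)%R; lia.
Qed.

(** The added 3 keeps the natural-number difference [c' - c] from truncating. *)
Lemma theta_graph_jumps_shift c c' : c < 3 -> c' < 3 ->
  theta_graph 3 (n * ((c' + 3 - c) %% 3)) (circulant N (jumps c)) = circulant N (jumps c').
Proof. by move=> c3 c'3; rewrite theta_graph_jumps //; do 2 f_equal; lia. Qed.

Lemma type2_jumps c c' : c < 3 -> c' < 3 -> c <> c' ->
  type2_iso N 3 (jumps c) (jumps c').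
Proof.
move=> c3 c'3 cc'; split.
  split; rewrite ?card_jumps //; try exact: jumps_jump_set.
  by move=> eqJ; apply: cc'; apply: circulant_jumps_inj; rewrite ?eqJ.
exists 3; first by case: c c3 {cc'} => [|[|[]]] //; rewrite !inE ?orbT.
split=> //; last by move=> x; apply: jumps_neq_mul.
- by rewrite dvdn_gcd dvdnn andbT dvdn_mulr.
- by rewrite dvdn_mulr.
- exists (n * ((c' + 3 - c) %% 3)); last exact: theta_graph_jumps_shift.
  (* As [c] and [c'] differ, the parameter is [n] or [2n], within the bound [9n - 1]. *)
  have /andP[k0 k3] : 0 < (c' + 3 - c) %% 3 < 3 by lia.
  have -> : N %/ 3 = 9 * n by lia.
  have := leq_mul (leqnn n) k0; have := leq_mul (leqnn n) k3; lia.
Qed.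

(** * The Type-2 sets and their group structure *)

Lemma T2_jumps c : c < 3 ->
  T2 N 3 (jumps c) = [set G | exists2 i, i < 3 & G = circulant N (jumps i)]%classic.
Proof.
move=> c3; apply/seteqP; split=> G.
  case=> [->|[A GA [_ [r _ [_ _ _ [t _ thG] _]]]]]; first by exists c.
  (* Circulance of the image forces [t = nk], so no Type-2 partner lies outside the three graphs. *)
  have /dvdnP[k kt] := theta_graph_dvd _ _ _ c3 thG.
  exists ((c + k) %% 3); first by rewrite ltn_pmod.
  by rewrite GA -thG kt (mulnC k) theta_graph_jumps.
move=> /= [i i3 GE]; have [ic|/eqP ic] := eqVneq i c; [left|right].
  by rewrite GE ic.
by exists (jumps i) => //; apply: type2_jumps => // ci; apply: ic.
Qed.

(** Indices are counted from the base [c'], so that the base graph is the neutral element; the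
    product on ['I_3] is addition modulo 3. *)
Lemma T2_jumps_group c c' : c < 3 -> c' < 3 ->
  group_iso 'I_3 (T2 N 3 (jumps c)) (T2_op N 3 (jumps c')).
Proof.
move=> c3 c'3; exists (fun a : 'I_3 => circulant N (jumps ((c' + a) %% 3))); split.
- move=> a b /circulant_jumps_inj; rewrite !ltn_pmod // => /(_ isT isT) ab.
  by apply: val_inj; have := ltn_ord a; have := ltn_ord b; rewrite /=; lia.
- rewrite T2_jumps //; apply/seteqP; split=> [_ [a _ <-]|_ [i i3 ->]].
    by exists ((c' + a) %% 3); rewrite // ltn_pmod.
  exists (Ordinal (ltn_pmod (i + 3 - c') (isT : 0 < 3))) => //=.
  by do 2 f_equal; lia.
have N3 : N %/ 3 = n * 9 by lia.
move=> a b K; rewrite /T2_op N3; split.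
  case=> t [t' [_ Ga Gb ->]].
  (* The graphs do not determine [t] and [t'], but these are multiples of [n] whose quotients are
     determined modulo 3. Reducing [t + t'] modulo [9n] reduces the sum of the quotients modulo 9,
     which preserves it modulo 3; hence [K] is unique. *)
  have /dvdnP[k tE] := theta_graph_dvd _ _ _ c'3 (esym Ga).
  have /dvdnP[k' t'E] := theta_graph_dvd _ _ _ c'3 (esym Gb).
  move: Ga Gb; rewrite tE t'E (mulnC k) (mulnC k') -mulnDr -muln_modr !theta_graph_jumps //.
  move=> /circulant_jumps_inj; rewrite !ltn_pmod // => /(_ isT isT) ak.
  move=> /circulant_jumps_inj; rewrite !ltn_pmod // => /(_ isT isT) bk.
  by do 2 f_equal; rewrite /=; lia.
move=> ->; exists (n * a), (n * b).
rewrite -mulnDr -muln_modr !theta_graph_jumps // !ltn_pmul2l //; split=> //.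
  by have := ltn_ord a; have := ltn_ord b; lia.
by do 2 f_equal; rewrite /=; lia.
Qed.

End Jumps.

Theorem theorem5p9 (n : nat) (hn : 0 < n) (N : nat) (R S T : {fset nat})
    (hN : N = 27 * n)
    (hR : R = [fset 1; 3; (9 * n - 1)%N; (9 * n + 1)%N]%fset)
    (hS : S = [fset 3; (3 * n + 1)%N; (6 * n - 1)%N; (12 * n + 1)%N]%fset)
    (hT : T = [fset 3; (3 * n - 1)%N; (6 * n + 1)%N; (12 * n - 1)%N]%fset) :
  [/\ type2_iso N 3 R S /\ type2_iso N 3 S R,
      type2_iso N 3 R T /\ type2_iso N 3 T R
    & type2_iso N 3 S T /\ type2_iso N 3 T S] /\
  [/\ T2 N 3 R = T2 N 3 S, T2 N 3 S = T2 N 3 T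
    & T2 N 3 T = [set circulant N R; circulant N S; circulant N T]%classic] /\
  (forall B : {fset nat}, B \in [:: R; S; T] ->
     [/\ (T2 N 3 R, T2_op N 3 B) = (T2 N 3 S, T2_op N 3 B),
         (T2 N 3 S, T2_op N 3 B) = (T2 N 3 T, T2_op N 3 B)
       & is_group (T2 N 3 B) (T2_op N 3 B)]) /\
  (forall B B' : {fset nat}, B \in [:: R; S; T] -> B' \in [:: R; S; T] ->
     groups_isomorphic (T2 N 3 B) (T2 N 3 B') (T2_op N 3 B) (T2_op N 3 B')).
Proof.
have [-> -> ->] : [/\ R = jumps n 0, S = jumps n 1 & T = jumps n 2] by [].
have type2 := type2_jumps n hn; have T2E := T2_jumps n hn.
have memP (B : {fset nat}) : B \in [:: jumps n 0; jumps n 1; jumps n 2] ->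
    exists2 c, c < 3 & B = jumps n c.
  by rewrite !inE => /or3P[]/eqP->; [exists 0|exists 1|exists 2].
rewrite {}hN; split; first by do 2 split; apply: type2.
split; [|split].
- rewrite !T2E //; split=> //; apply/seteqP; split=> G.
    by case=> [[|[|[|//]]]] _ ->; [left; left|left; right|right].
  by case=> [[]|] ->; [exists 0|exists 1|exists 2].
- move=> B /memP[c c3 ->]; split; first by rewrite !T2E.
    by rewrite !T2E.
  by exists 'I_3; apply: T2_jumps_group.
- move=> B B' /memP[c c3 ->] /memP[c' c'3 ->].
  exists 'I_3; split; first exact: T2_jumps_group.
  exact: T2_jumps_group.
Qed.
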